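(* Let $w\in\mathrm{F}_d$ be a non-trivial law such that there is some (finitely generated) group of exponential growth satisfying $w$. Then $w$ has no strong gap with respect to measures induced by uniform measures on balls. That is, there is no $\varepsilon>0$ with the following property: for every finitely generated group $\Gamma$ and every finite symmetric generating set $T$ of $\Gamma$ containing $1$, if $\limsup_{n\to\infty}\Pr_{\mu_n}(w=1\text{ on }\Gamma)>1-\varepsilon$, where $\mu_n$ is the uniform measure on $T^n$, then $\Gamma$ satisfies $w$.
   Context: For a probability measure $\mu$ on a group $\Gamma$ and a word $w$ in $d$ letters, $\Pr_\mu(w=1\text{ on }\Gamma)$ is the probability that $w(g_1,\dots,g_d)=1$ when $g_1,\dots,g_d$ are independent with law $\mu$. $\Gamma$ satisfies $w$ if $w(g_1,\dots,g_d)=1$ for all $g_i\in\Gamma$. $T^n$ is the set of products of $n$ elements of $T$, i.e. the ball of radius $n$ around the identity in the Cayley graph. A finitely generated group has exponential growth if $\lim_{n\to\infty}|S^n|^{1/n}>1$ for a finite symmetric generating set $S$ containing $1$. *)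

(* Defs.v *)
From HB Require Import structures.
From mathcomp Require Import all_boot all_order all_algebra finmap.
From mathcomp Require Import all_classical all_reals all_analysis.

Set Implicit Arguments.
Unset Strict Implicit.
Unset Printing Implicit Defensive.

Import Order.TTheory GRing.Theory Num.Theory.
Import numFieldNormedType.Exports.

Local Open Scope classical_set_scope.
Local Open Scope fset_scope.
Local Open Scope ring_scope.

(* The letter (i, false) stands for the generator x_i of the free group and
   (i, true) for its inverse. *)
Definition letter (d : nat) := ('I_d * bool)%type.

Definition inv_letter (d : nat) (x : letter d) : letter d := (x.1, ~~ x.2).

Definition reduced (d : nat) (s : seq (letter d)) : bool :=
  sorted (fun x y => y != inv_letter x) s.

(* The underlying set of the free group F_d is that of the reduced words, and
   the identity is the empty word.  The group law of F_d is not needed to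
   evaluate words in a group. *)
Record free_word (d : nat) := FreeWord {
  letters :> seq (letter d);
  letters_reduced : reduced letters }.

Definition trivial_word (d : nat) (w : free_word d) : bool := nilp w.

Definition letter_eval (G : groupType) (d : nat) (g : {ffun 'I_d -> G})
    (x : letter d) : G :=
  if x.2 then (g x.1)^-1%g else g x.1.

(* w(g_1, ..., g_d) *)
Definition word_eval (G : groupType) (d : nat) (w : free_word d)
    (g : {ffun 'I_d -> G}) : G :=
  (\prod_(x <- letters w) letter_eval g x)%g.

Definition satisfies (G : groupType) (d : nat) (w : free_word d) : Prop :=
  forall g : {ffun 'I_d -> G}, word_eval w g = 1%g.

Definition generates (G : groupType) (T : {fset G}) : Prop :=
  forall H : {pred G}, group_closed H -> {subset T <= H} ->
  forall g : G, g \in H.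

Definition sym_gen_set (G : groupType) (T : {fset G}) : Prop :=
  [/\ 1%g \in T, (forall x, x \in T -> x^-1%g \in T) & generates T].

(* T^n *)
Definition word_ball (G : groupType) (T : {fset G}) (n : nat) : {fset G} :=
  iter n (fun A : {fset G} => [fset (x * y)%g | x in A, y in T]) [fset 1%g].

Definition exponential_growth (R : realType) (G : groupType) : Prop :=
  exists S : {fset G}, sym_gen_set S /\
  exists2 l : R, 1 < l &
    (#|` word_ball S n|%:R `^ n%:R^-1) @[n --> \oo] --> l.

(* The mass function of the uniform measure on A. *)
Definition uniform_mass (R : realType) (G : groupType) (A : {fset G})
    (g : G) : R :=
  if g \in A then #|` A|%:R^-1 else 0.

(* Pr_mu(w = 1 on G), for the discrete probability measure with mass function
   mu: by independence, (g_1, ..., g_d) has mass mu(g_1) ... mu(g_d). *)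
Definition word_prob (R : realType) (G : groupType) (d : nat)
    (w : free_word d) (mu : G -> R) : \bar R :=
  \esum_(g in [set g : {ffun 'I_d -> G} | word_eval w g = 1%g])
    (\prod_(i < d) mu (g i))%:E.

Definition strong_gap_for_balls (R : realType) (d : nat) (w : free_word d) :
    Prop :=
  exists2 eps : R, 0 < eps &
  forall (G : groupType) (T : {fset G}), sym_gen_set T ->
    ((1 - eps)%:E < limn_esup
       (fun n => word_prob w (uniform_mass R (word_ball T n))))%E ->
    satisfies G w.

(* Main.v *)
Require Import Defs.
From mathcomp Require Import all_boot all_order all_algebra fingroup perm finmap.
From mathcomp Require Import all_classical all_reals all_analysis.
From mathcomp Require Import lra.

(** Let G be a group of exponential growth, with generating set S, that
    satisfies w, and let H be a finite group that does not satisfy w.  The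
    product of G and H does not satisfy w, but its generators can be chosen
    so that most of a ball lies in the copy of G, where w is always 1.

    To this end, generate the factor G by the whole ball S^m and the factor H
    by all its elements ([prod_gens]).  Stepping out of G then costs one
    letter, and that letter could have added m to the length in S: the ball
    of radius n + 1 consists of S^(m(n+1)) x 1 together with elements of
    S^(mn) x H.  As S has exponential growth, m can be chosen so that
    |S^(m(n+1))| exceeds |S^(mn)| by any prescribed factor for
    infinitely many n ([growth_steps]); for those n a uniform random element
    of the ball is in G with probability at least 1 - x, with x as small as
    desired ([card_ball_prod_gens]).  Then d independent elements are all in
    G with probability at least 1 - d x, which bounds the limsup from below.

    For H one takes the symmetric group on the positions 0, ..., k of a
    nonempty reduced word of length k ([word_eval_perm_neq1]): each letter is
    to move its position to the next one, reducedness makes these requirements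
    compatible, and w then moves 0 to k. *)

Import Order.TTheory GRing.Theory Num.Theory.
Import numFieldNormedType.Exports.

Set Implicit Arguments.
Unset Strict Implicit.
Unset Printing Implicit Defensive.

Local Open Scope classical_set_scope.
Local Open Scope fset_scope.
Local Open Scope ring_scope.

(** * A finite group that does not satisfy a given word *)

(** Any finite partial injection extends to a permutation: one more
    requirement src x |-> tgt x is met by composing with the transposition of
    the present image of src x and tgt x, which moves none of the images that
    were prescribed before. *)
Lemma perm_extending (T : finType) (J : eqType) (D : seq J) (src tgt : J -> T) :
  {in D &, injective src} -> {in D &, injective tgt} ->
  exists p : {perm T}, {in D, forall j, p (src j) = tgt j}.
Proof.
elim: D => [_ _|x D IH srcI tgtI]; first by exists 1%g.
have DS : {subset D <= x :: D} by move=> y yD; rewrite inE yD orbT.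
have [p pD] := IH (sub_in2 DS srcI) (sub_in2 DS tgtI).
have [xD|xND] := boolP (x \in D).
  by exists p => j; rewrite inE => /predU1P[->|]; exact: pD.
exists (p * tperm (p (src x)) (tgt x))%g => j.
rewrite inE permM => /predU1P[->|jD]; first by rewrite tpermL.
have xj : x != j by apply: contraNneq xND => ->.
rewrite (pD j jD) tpermD//.
- rewrite -(pD j jD) (inj_eq perm_inj); apply: contra_neq xj.
  by apply: srcI; rewrite ?inE ?eqxx// jD orbT.
- by apply: contra_neq xj; apply: tgtI; rewrite ?inE ?eqxx// jD orbT.
Qed.

(** A nontrivial reduced word is not a law of the finite symmetric groups:
    this is the usual proof that free groups are residually finite. *)
Lemma word_eval_perm_neq1 (d : nat) (w : free_word d) : ~~ trivial_word w ->
  exists g : {ffun 'I_d -> {perm 'I_(size w).+1}}, word_eval w g != 1%g.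
Proof.
case: w => [[|x0 s]] wred; rewrite /trivial_word //= => _.
set w := x0 :: s in wred *; set n := size w.
(* The letter at position j must move j to j + 1.  For the underlying generator
   this means node true j |-> node false j: the two ends of the step, swapped
   if the letter is an inverse. *)
pose node b j : 'I_n.+1 := inord (if (nth x0 w j).2 == b then j.+1 else j).
pose D i := [seq j <- iota 0 n | (nth x0 w j).1 == i].
have memD i j : (j \in D i) = ((nth x0 w j).1 == i) && (j < n)%N.
  by rewrite mem_filter mem_iota.
(* In a reduced word, neighbours on the same generator have the same sign. *)
have adj j : (j.+1 < n)%N ->
    (nth x0 w j.+1).1 = (nth x0 w j).1 -> (nth x0 w j.+1).2 = (nth x0 w j).2.
  move=> jn; have /(sortedP x0)/(_ _ jn) := wred.
  rewrite /inv_letter; case: (nth x0 w j.+1) (nth x0 w j) => [a e] [b f] /= + ab.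
  by rewrite ab xpair_eqE eqxx; case: e; case: f.
have noadj i j k : j \in D i -> k \in D i ->
   (nth x0 w j).2 != (nth x0 w k).2 -> j != k.+1.
  rewrite !memD => /andP[/eqP ji jn] /andP[/eqP ki kn]; apply: contraNneq => jk.
  by rewrite jk adj ?eqxx -?jk// ji ki.
have inordI a b : (a <= n)%N -> (b <= n)%N -> inord a = inord b :> 'I_n.+1 -> a = b.
  by move=> an bn /(congr1 val); rewrite /= !inordK.
(* Positions with equal signs are shifted alike.  With opposite signs, equal
   nodes would make the two positions adjacent. *)
have nodeI b i : {in D i &, injective (node b)}.
  move=> j k jD kD; have := noadj _ _ _ jD kD; have := noadj _ _ _ kD jD.
  move: jD kD; rewrite !memD => /andP[_ jn] /andP[_ kn].
  rewrite /node.
  have [sjk _ _|sjk /(_ isT) kj /(_ isT) jk] :=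
    eqVneq (nth x0 w j).2 (nth x0 w k).2.
    rewrite sjk; case: ifP => _ /inordI; first by move=> /(_ jn kn)[].
    by apply; exact: ltnW.
  have -> : ((nth x0 w k).2 == b) = ((nth x0 w j).2 != b).
    by move: sjk; case: (nth x0 w j).2 (nth x0 w k).2 b => [] [] [].
  case: ifP => _ /inordI/= => [/(_ jn (ltnW kn))|/(_ (ltnW jn) kn)] /eqP e.
    by move: kj; rewrite eq_sym e.
  by move: jk; rewrite e.
have /fin_all_exists[g gE] i := perm_extending (nodeI true i) (nodeI false i).
exists (finfun g); rewrite /word_eval /=.
(* A product of permutations applies its leftmost factor first. *)
have walk j : (j <= n)%N ->
   (\prod_(x <- take j w) letter_eval (finfun g) x)%g (inord 0 : 'I_n.+1) = inord j.
  elim: j => [_|j IH jn]; first by rewrite take0 big_nil perm1.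
  rewrite (take_nth x0 jn) -cats1 big_cat big_seq1 permM IH 1?ltnW//.
  have := gE (nth x0 w j).1 j; rewrite memD eqxx => /(_ jn).
  rewrite /node /letter_eval ffunE; case: (nth x0 w j).2 => //= <-.
  by rewrite permK.
have := walk n (leqnn n); rewrite take_size => w0n.
apply/eqP => w1; move: w0n; rewrite w1 perm1 => /inordI.
by rewrite leq0n leqnn => /(_ isT isT).
Qed.

(** * Exponential growth *)

Lemma exists_expr_gt (R : realType) (r M : R) : 1 < r ->
  exists2 m, (0 < m)%N & M < r ^+ m.
Proof.
move=> r1; have r0 : 0 < r by apply: lt_trans r1.
have M0 : 0 < `|M| + 1 by rewrite ltr_wpDl.
have rV : `|r^-1| < 1 by rewrite ger0_norm ?invr_ge0 ?ltW// invf_cp1.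
have MV0 : 0 < (`|M| + 1)^-1 by rewrite invr_gt0.
have [m _ /(_ (maxn m 1))] := cvgr_lt _ (cvg_expr rV) _ MV0.
rewrite /= leq_maxl => /(_ isT); rewrite exprVn ltf_pV2 ?posrE ?exprn_gt0// => MR.
exists (maxn m 1); first by rewrite leq_max orbT.
by apply: le_lt_trans MR; rewrite ler_wpDr// ler_norm.
Qed.

(** If a(m(n+1)) < K a(mn) held for all large n, then a(mn) would grow at most
    like K^n, while it eventually dominates r^(mn) for any r in ]1, l[.  This is
    absurd once r^m > 2K. *)
Lemma growth_steps (R : realType) (a : nat -> nat) (l K : R) :
  1 < l -> (a n)%:R `^ n%:R^-1 @[n --> \oo] --> l -> 0 < K ->
  exists2 m, (0 < m)%N &
    forall N, exists2 n, (N <= n)%N & K * (a (m * n)%N)%:R <= (a (m * n.+1)%N)%:R.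
Proof.
move=> l1 a_l K0; have [r r1 rl] : exists2 r, 1 < r & r < l.
  by exists ((1 + l) / 2); lra.
have r0 : 0 < r by lra.
have [N0 _ aN0] := cvgr_gt _ a_l _ rl.
have {aN0} a_ge n : (N0 <= n)%N -> (0 < n)%N -> r ^+ n <= (a n)%:R.
  move=> /aN0/= /ltW ra n0.
  have -> : (a n)%:R = ((a n)%:R `^ n%:R^-1) ^+ n :> R.
    rewrite -(powR_mulrn n) ?powR_ge0// -powRrM mulVf ?powRr1//.
    by rewrite pnatr_eq0 -lt0n.
  by rewrite lerXn2r ?nnegrE ?powR_ge0// ltW.
have [m m0 rm] := exists_expr_gt (2 * K) r1.
exists m => // N; apply: contrapT => noN.
have step n : (N <= n)%N -> (a (m * n.+1)%N)%:R <= K * (a (m * n)%N)%:R.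
  by move=> Nn; rewrite leNgt; apply/negP => /ltW ?; apply: noN; exists n.
pose N1 := (maxn N N0).+1.
have N1N : (N <= N1)%N by rewrite ltnW// ltnS leq_maxl.
have N1N0 : (N0 <= N1)%N by rewrite ltnW// ltnS leq_maxr.
have upper k : (a (m * (N1 + k))%N)%:R <= K ^+ k * (a (m * N1)%N)%:R.
  elim: k => [|k IH]; first by rewrite addn0 mul1r.
  rewrite addnS exprS -mulrA; apply: le_trans (step _ _) _.
    exact: leq_trans (leq_addr _ _).
  by rewrite ler_pM2l.
have lower k : 2 ^+ k * K ^+ k * (2 * K) ^+ N1 <= (a (m * (N1 + k))%N)%:R.
  apply: le_trans (a_ge _ _ _); last 2 first.
  - by rewrite (leq_trans N1N0)// (leq_trans (leq_addr k _))// leq_pmull.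
  - by rewrite muln_gt0 m0.
  rewrite exprM -exprMn -exprD addnC lerXn2r ?nnegrE ?ltW//.
    by rewrite mulr_gt0.
  by rewrite exprn_gt0.
have C0 : 0 < (2 * K) ^+ N1 by rewrite exprn_gt0// mulr_gt0.
have [k _] := exists_expr_gt ((a (m * N1)%N)%:R / (2 * K) ^+ N1) (ltr1n R 2).
apply/negP; rewrite -leNgt ler_pdivlMr//.
rewrite -(ler_pM2l (exprn_gt0 k K0)) mulrA [_ * 2 ^+ k]mulrC.
exact: le_trans (lower k) (upper k).
Qed.

(** * Balls in Cayley graphs *)

Section Balls.
Variable G : groupType.
Implicit Types (T : {fset G}) (n m : nat) (x y g : G).

Lemma word_ballS T n g :
  reflect (exists2 x, x \in word_ball T n & exists2 y, y \in T & g = (x * y)%g)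
    (g \in word_ball T n.+1).
Proof. exact: imfset2P. Qed.

Lemma word_ball0 T g : (g \in word_ball T 0) = (g == 1%g).
Proof. by rewrite /word_ball /= inE. Qed.

Lemma word_ball_mul T m n x y :
  x \in word_ball T m -> y \in word_ball T n -> (x * y)%g \in word_ball T (m + n).
Proof.
move=> xm; elim: n y => [y|n IH y].
  by rewrite word_ball0 => /eqP ->; rewrite mulg1 addn0.
case/word_ballS => z zn [t tT ->]; rewrite addnS mulgA; apply/word_ballS.
by exists (x * z)%g; [exact: IH|exists t].
Qed.

Lemma word_ball_split T m n g : g \in word_ball T (m + n) ->
  exists2 x, x \in word_ball T m & exists2 y, y \in word_ball T n & g = (x * y)%g.
Proof.
elim: n g => [g|n IH g].
  by rewrite addn0 => gm; exists g => //; exists 1%g; rewrite ?word_ball0 ?mulg1.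
rewrite addnS => /word_ballS[h /IH[x xm [y yn ->]] [t tT ->]].
exists x => //; exists (y * t)%g; rewrite ?mulgA//.
by apply/word_ballS; exists y => //; exists t.
Qed.

Lemma word_ball1 T g : (g \in word_ball T 1) = (g \in T).
Proof.
apply/word_ballS/idP => [[x]|gT].
  by rewrite word_ball0 => /eqP -> [y yT ->]; rewrite mul1g.
by exists 1%g; [rewrite word_ball0|exists g; rewrite ?mul1g].
Qed.

Section Gen.
Variable T : {fset G}.
Hypothesis T_gen : sym_gen_set T.

Lemma mem1_word_ball n : 1%g \in word_ball T n.
Proof.
case: T_gen => T1 _ _; elim: n => [|n IH]; first by rewrite word_ball0.
by apply/word_ballS; exists 1%g => //; exists 1%g; rewrite ?mulg1.
Qed.

Lemma word_ball_inv n g : g \in word_ball T n -> g^-1%g \in word_ball T n.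
Proof.
case: T_gen => _ TV _; elim: n g => [g|n IH g].
  by rewrite !word_ball0 => /eqP ->; rewrite invg1.
case/word_ballS => x xn [y yT ->]; rewrite invgM -add1n; apply: word_ball_mul (IH _ xn).
by rewrite word_ball1 TV.
Qed.

Lemma word_ball_subset m n : (m <= n)%N -> {subset word_ball T m <= word_ball T n}.
Proof.
move=> /subnKC <- x xm; rewrite -[x]mulg1; apply: word_ball_mul xm _.
exact: mem1_word_ball.
Qed.
End Gen.
End Balls.

(** * Balls in the product with a finite group *)

Section Product.
Variables (G : groupType) (H : finGroupType) (S : {fset G}).
Hypothesis S_gen : sym_gen_set S.

Definition prod_gens m : {fset (G * H)%type} :=
  [fset (x, 1%g) | x in word_ball S m] `|` [fset (1%g, h) | h : H].

Lemma prod_gensP m (z : G * H) :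
  reflect ((z.1 \in word_ball S m /\ z.2 = 1%g) \/ z.1 = 1%g) (z \in prod_gens m).
Proof.
rewrite inE; apply: (iffP orP) => [[/imfsetP[x /= xm ->]|/imfsetP[h _ ->]]|].
- by left.
- by right.
case: z => x h /= [[xm ->]|->]; [left|right]; apply/imfsetP; first by exists x.
by exists h.
Qed.

Lemma prod_gens_sym_gen_set m : (0 < m)%N -> sym_gen_set (prod_gens m).
Proof.
move=> m0; case: (S_gen) => S1 SV Sgen; split.
- by apply/prod_gensP; right.
- move=> z /prod_gensP[[zm z2]|z1]; apply/prod_gensP; [left|right] => /=.
    by rewrite z2 invg1; split=> //; exact: word_ball_inv.
  by rewrite z1 invg1.
move=> A A_grp TA [x h].
have -> : (x, h) = ((x, 1) * (1, h))%g :> (G * H)%type.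
  by congr (_, _); rewrite /= ?mulg1 ?mul1g.
apply: group_closedM => //; last by apply: TA; apply/prod_gensP; right.
apply: (Sgen [pred y | (y, 1%g : H) \in A]) => [|y yS].
  split=> [|y z yA zA]; first by rewrite inE; case: A_grp.
  rewrite !inE in yA zA *.
  have -> : (y / z, 1)%g = ((y, 1%g) / (z, 1%g))%g :> (G * H)%type.
    by congr (_, _); rewrite /= divg1.
  by case: A_grp => _; apply.
rewrite inE; apply: TA; apply/prod_gensP; left; split=> //=.
by apply: (word_ball_subset S_gen m0); rewrite word_ball1.
Qed.

Lemma mem_ball_prod_gens m n x : x \in word_ball S (m * n) ->
  (x, 1%g) \in word_ball (prod_gens m) n.
Proof.
elim: n x => [x|n IH x].
  by rewrite muln0 !word_ball0 => /eqP ->.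
rewrite mulnS addnC => /word_ball_split[y ymn [z zm ->]].
apply/word_ballS; exists (y, 1%g); first exact: IH.
exists (z, 1%g); first by apply/prod_gensP; left.
by congr (_, _); rewrite /= mulg1.
Qed.

(** A word of length n + 1 either uses generators from S^m only, or at least one
    of its letters is in H and does not contribute to the first coordinate. *)
Lemma ball_prod_gens_sub m n z : z \in word_ball (prod_gens m) n.+1 ->
  (z.1 \in word_ball S (m * n.+1) /\ z.2 = 1%g) \/ z.1 \in word_ball S (m * n).
Proof.
elim: n z => [z|n IH z].
  rewrite word_ball1 => /prod_gensP[[zm z2]|z1]; [left|right].
    by rewrite muln1.
  by rewrite muln0 word_ball0 z1.
case/word_ballS => x /IH + [y /prod_gensP + ->].
move=> [[xm x2]|xm] [[ym y2]|y1] /=.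
- left; rewrite x2 y2 mulg1; split=> //.
  by rewrite [(m * n.+2)%N]mulnS addnC; exact: word_ball_mul.
- by right; rewrite y1 mulg1.
- by right; rewrite mulnS addnC; exact: word_ball_mul.
- right; rewrite y1 mulg1; apply: word_ball_subset xm => //.
  by rewrite leq_mul2l leqnSn orbT.
Qed.

Lemma card_ball_prod_gens m n :
  (#|` word_ball (prod_gens m) n.+1| <=
   #|` word_ball S (m * n.+1)| + #|` word_ball S (m * n)| * #|H|)%N.
Proof.
pose s := [seq (x, 1%g : H) | x <- word_ball S (m * n.+1)] ++
          [seq (x, h) | x <- word_ball S (m * n), h <- enum H].
have -> : (#|` word_ball S (m * n.+1)| + #|` word_ball S (m * n)| * #|H|)%N
    = size s by rewrite size_cat size_map size_allpairs -cardE.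
apply: uniq_leq_size => // -[x h] /ball_prod_gens_sub/= [[xm ->]|xm].
  by rewrite mem_cat map_f.
by rewrite mem_cat allpairs_f ?orbT// mem_enum.
Qed.

Lemma word_eval_pair (d : nat) (w : free_word d) (g : {ffun 'I_d -> G * H}) :
  word_eval w g = (word_eval w [ffun i => (g i).1], word_eval w [ffun i => (g i).2]).
Proof.
rewrite /word_eval; elim: (letters w) => [|x s IH]; first by rewrite !big_nil.
by rewrite !big_cons IH /letter_eval !ffunE; case: ifP.
Qed.
End Product.

Lemma word_eval1 (G : groupType) (d : nat) (w : free_word d) :
  word_eval w [ffun=> 1%g : G] = 1%g.
Proof.
rewrite /word_eval big1// => x _.
by rewrite /letter_eval ffunE invg1 if_same.
Qed.

(** * Probability that a word is trivial *)

(** If w is trivial on A, all d-tuples from A contribute, and a tuple of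
    independent uniform elements of B falls in A with the d-th power of the
    probability that one of them does. *)
Lemma word_prob_uniform_ge (R : realType) (G : groupType) (d : nat) (w : free_word d)
  (A B : {fset G}) : A `<=` B ->
  (forall g : {ffun 'I_d -> G}, (forall i, g i \in A) -> word_eval w g = 1%g) ->
  (((#|` A|%:R / #|` B|%:R) ^+ d)%:E <= word_prob w (uniform_mass R B))%E.
Proof.
move=> AB w1.
pose lift (f : {ffun 'I_d -> A}) : {ffun 'I_d -> G} := [ffun i => val (f i)].
have lift_inj : injective lift.
  move=> f1 f2 /ffunP f12; apply/ffunP => i; have := f12 i.
  by rewrite !ffunE; exact: val_inj.
pose X := [fset lift f | f : {ffun 'I_d -> A}].
have XA g : g \in X -> forall i, g i \in A.
  by case/imfsetP => f _ -> i; rewrite ffunE; exact: valP.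
apply: esum_ge; exists [set` X].
  by split => [|g /= /XA]; [exact: finite_fset|exact: w1].
rewrite fsbig_finite//= set_fsetK sumEFin lee_fin.
rewrite big_seq (eq_bigr (fun=> (#|` B|%:R^-1) ^+ d)); last first.
  move=> g /XA gA.
  rewrite (eq_bigr (fun=> #|` B|%:R^-1)) ?prodr_const ?card_ord// => i _.
  by rewrite /uniform_mass (fsubsetP AB) ?gA.
rewrite -big_seq big_const_seq count_predT iter_addr_0 card_imfset//=.
by rewrite -cardE card_ffun card_ord -cardfE -[leRHS]mulr_natl natrX exprMn.
Qed.

Lemma limn_esup_ge (R : realType) (u : nat -> \bar R) (c : \bar R) :
  (forall N, exists2 n, (N <= n)%N & (c <= u n)%E) -> (c <= limn_esup u)%E.
Proof.
move=> uc; apply: le_ereal_inf_tmp => /= _ [A [N _ NA] <-].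
have [n Nn cn] := uc N.
by apply: le_ereal_sup_tmp; exists (u n) => //; exists n => //; exact: NA.
Qed.

Lemma bernoulli_expr_onem (R : realDomainType) (x : R) d :
  0 <= x <= 1 -> 1 - d%:R * x <= (1 - x) ^+ d.
Proof.
move=> /andP[x0 x1]; elim: d => [|d IH]; first by rewrite mul0r subr0.
rewrite exprS; apply: le_trans (_ : (1 - x) * (1 - d%:R * x) <= _); last first.
  by rewrite ler_wpM2l// subr_ge0.
rewrite -natr1; have := ler0n R d; nra.
Qed.

(** * The theorem *)

Unset Implicit Arguments.

Theorem theorem12p1 (R : realType) (d : nat) (w : free_word d)
  (w_nontrivial : ~~ trivial_word w)
  (w_exp : exists G : groupType, exponential_growth R G /\ satisfies G w) :
  ~ strong_gap_for_balls R w.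
Proof.
case: w_exp => G [[S [S_gen [l l1 S_l]]] Gw] [eps eps0 gap].
have [h wh] := word_eval_perm_neq1 w_nontrivial.
pose H : finGroupType := {perm 'I_(size w).+1}; rewrite -/H in h wh.
have H0 : 0 < #|H|%:R :> R by rewrite ltr0n; apply/card_gt0P; exists 1%g.
have d0 : 0 <= d%:R :> R := ler0n R d.
(* x is a bound for the probability of leaving G such that d x < eps.  The
   elements outside G number at most |H| |S^(mn)|, hence the growth factor
   |H| / x below. *)
pose x := eps / (eps + d%:R).
have ed0 : 0 < eps + d%:R by lra.
have x0 : 0 < x by rewrite divr_gt0.
have x1 : x <= 1 by rewrite ler_pdivrMr// mul1r; lra.
have dx : d%:R * x < eps.
  by rewrite mulrA ltr_pdivrMr// mulrC ltr_pM2l//; lra.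
have [m m0 steps] := growth_steps l1 S_l (divr_gt0 H0 x0).
suff /gap/(_ [ffun i => (1%g, h i)]) : ((1 - eps)%:E < limn_esup (fun n =>
    word_prob w (uniform_mass R (word_ball (prod_gens H S m) n))))%E.
  move=> /(_ (prod_gens_sym_gen_set _ S_gen m0)) /(congr1 snd).
  rewrite word_eval_pair /=; set h' := finfun _; move/eqP.
  suff -> : h' = h by apply/negP.
  by apply/ffunP => i; rewrite !ffunE.
apply: (@lt_le_trans _ _ (1 - d%:R * x)%:E); first by rewrite lte_fin; lra.
apply: limn_esup_ge => N; have [n Nn step] := steps N.
exists n.+1; first exact: leqW.
set B := word_ball _ _.
pose A := [fset (g, 1%g : H) | g in word_ball S (m * n.+1)].
have cardA : #|` A| = #|` word_ball S (m * n.+1)|.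
  by rewrite card_imfset// => ? ? [].
have AB : A `<=` B.
  by apply/fsubsetP => _ /imfsetP[g gS ->]; exact: mem_ball_prod_gens.
have wA (g : {ffun 'I_d -> G * H}) : (forall i, g i \in A) -> word_eval w g = 1%g.
  move=> gA; rewrite word_eval_pair Gw.
  have -> : [ffun i => (g i).2] = [ffun=> 1%g].
    by apply/ffunP => i; rewrite !ffunE; case/imfsetP: (gA i) => ? _ ->.
  by rewrite word_eval1.
apply: le_trans (word_prob_uniform_ge R AB wA); rewrite lee_fin.
apply: le_trans (bernoulli_expr_onem _ _) _; first by rewrite (ltW x0).
have A0 : (0 < #|` A|)%N.
  by rewrite cardA cardfs_gt0; apply/fset0Pn; exists 1%g; exact: mem1_word_ball.
have B0 : (0 < #|` B|)%N := leq_trans A0 (fsubset_leq_card AB).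
rewrite lerXn2r ?nnegrE ?divr_ge0 ?subr_ge0// ler_pdivlMr ?ltr0n//.
(* It remains to see (1 - x) b <= a, with b <= a + |H| c and |H| c <= x a;
   indeed (1 - x) (1 + x) <= 1. *)
have := card_ball_prod_gens H S_gen m n; rewrite -cardA -(ler_nat R) natrD natrM.
move: step; rewrite -cardA mulrAC ler_pdivrMr// -/B.
set a := #|` A|%:R; set b := #|` B|%:R; set c := #|` _|%:R.
have a0 : 0 < a by rewrite ltr0n.
nra.
Qed.
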